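(* Let $X$ be a separable Banach space and let $Y$ be a reflexive and separable Banach space. Let $K\subset Y$ be a closed convex normal cone and let $k\in K\setminus\{0\}$. Let $f:X\rightarrow Y$ be strongly $\alpha(\cdot)$-$k$-paraconvex on $X$ and locally vector-bounded on $X$ (with respect to $K$). Then there is a dense $G_\delta$ subset of $X$ at every point of which $f$ is Gâteaux differentiable.
   Context: Spaces are real. $\alpha:[0,+\infty)\to[0,+\infty)$ is a nondecreasing function with $\lim_{t\to 0^+}\alpha(t)/t=0$. A convex cone $K\subset Y$ is a set with $K+K\subset K$ and $\lambda K\subset K$ for all $\lambda\ge 0$; it defines the relation $x\le_K y \Leftrightarrow y-x\in K$. The cone $K$ is normal if there is $\gamma>0$ such that $0\le_K x\le_K y$ implies $\|x\|\le\gamma\|y\|$ for all $x,y\in Y$. For an open convex set $\Omega\subset X$ and $0\ne k\in K$, a continuous mapping $f:X\to Y$ is strongly $\alpha(\cdot)$-$k$-paraconvex on $\Omega$ if there is a constant $C>0$ such that for all $x,y\in\Omega$ and $0\le\lambda\le1$ $$f(\lambda x+(1-\lambda)y)\le_K \lambda f(x)+(1-\lambda)f(y)+C\min\{\lambda,1-\lambda\}\,\alpha(\|x-y\|)\,k.$$ $f$ is locally vector-bounded on an open convex set $\Omega$ if for every $x_0\in\Omega$ there are an open set $U\ni x_0$ and an element $k'\in K$ such that $-k'\le_K f(x)\le_K k'$ for all $x\in U$. $f$ is Gâteaux differentiable at $x_0$ if the norm limit $f'(x_0;h)=\lim_{t\to0}\frac{f(x_0+th)-f(x_0)}{t}$ (two-sided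 in $t$) exists for every $h\in X$ and the map $h\mapsto f'(x_0;h)$ is linear and continuous. *)

(* Defs.v *)
From HB Require Import structures.
From mathcomp Require Import all_boot all_order all_algebra.
From mathcomp Require Import all_classical all_reals all_analysis.
Import Order.TTheory GRing.Theory Num.Theory.
Import numFieldNormedType.Exports.

Set Implicit Arguments.
Unset Strict Implicit.
Unset Printing Implicit Defensive.

Local Open Scope classical_set_scope.
Local Open Scope ring_scope.

Definition separable_space (T : topologicalType) : Prop :=
  exists2 D : set T, countable D & dense D.

Section Reflexivity.
Variables (R : realType) (Y : normedModType R).

Definition dual_space : set (Y -> R^o) :=
  [set phi | linear phi /\ continuous phi].

Definition dual_norm (phi : Y -> R^o) : R :=
  sup [set `|phi y| | y in [set y : Y | `|y| <= 1]].

(* A bounded linear functional on the dual is represented by a function on all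
   maps Y -> R; only its values on [dual_space] matter. *)
Definition bidual_space : set ((Y -> R^o) -> R^o) :=
  [set Phi |
    (forall (a : R) (phi psi : Y -> R^o), dual_space phi -> dual_space psi ->
       Phi (a *: phi + psi) = a *: Phi phi + Phi psi) /\
    (exists M : R, forall phi : Y -> R^o, dual_space phi ->
       `|Phi phi| <= M * dual_norm phi)].

(* Surjectivity of the canonical embedding of Y into its bidual. *)
Definition reflexive_space : Prop :=
  forall Phi : (Y -> R^o) -> R^o, bidual_space Phi ->
    exists y : Y, forall phi : Y -> R^o, dual_space phi -> Phi phi = phi y.

End Reflexivity.

Section Cones.
Variables (R : realType) (Y : normedModType R).
Implicit Type K : set Y.

Definition convex_cone K : Prop :=
  (forall x y : Y, K x -> K y -> K (x + y)) /\
  (forall (l : R) (x : Y), 0 <= l -> K x -> K (l *: x)).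

Definition cone_le K (x y : Y) : Prop := K (y - x).

Definition normal_cone K : Prop :=
  exists2 gamma : R, 0 < gamma &
    forall x y : Y, cone_le K 0 x -> cone_le K x y -> `|x| <= gamma * `|y|.

End Cones.

(* The modulus is a function on [0, +oo), so nothing is required of the values
   of [alpha] at negative arguments. *)
Definition paraconvexity_modulus (R : realType) (alpha : R -> R) : Prop :=
  [/\ forall t : R, 0 <= t -> 0 <= alpha t,
      forall s t : R, 0 <= s -> s <= t -> alpha s <= alpha t &
      alpha t / t @[t --> (0 : R)^'+] --> (0 : R)].

Section VectorValuedMaps.
Variables (R : realType) (X Y : normedModType R).

Definition strongly_paraconvex (alpha : R -> R) (K : set Y) (k : Y)
    (Omega : set X) (f : X -> Y) : Prop :=
  continuous f /\
  exists2 C : R, 0 < C &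
    forall (x y : X) (l : R), Omega x -> Omega y -> 0 <= l -> l <= 1 ->
      cone_le K (f (l *: x + (1 - l) *: y))
        (l *: f x + (1 - l) *: f y
         + (C * Num.min l (1 - l) * alpha `|x - y|) *: k).

Definition locally_vector_bounded (K : set Y) (Omega : set X) (f : X -> Y)
    : Prop :=
  forall x0 : X, Omega x0 ->
    exists (U : set X) (k' : Y), [/\ open U, U x0, K k' &
      forall x : X, U x -> cone_le K (- k') (f x) /\ cone_le K (f x) k'].

Definition gateaux_differentiable (f : X -> Y) (x0 : X) : Prop :=
  [/\ forall h : X, derivable f x0 h,
      linear (fun h : X => 'D_h f x0) &
      continuous (fun h : X => 'D_h f x0)].

End VectorValuedMaps.

(* Main.v *)
Require Import Defs.
From HB Require Import structures.
From mathcomp Require Import all_boot all_order all_algebra.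
From mathcomp Require Import all_classical all_reals all_analysis.
From mathcomp Require Import borel_hierarchy ring lra.
Import Order.TTheory GRing.Theory Num.Theory.
Import numFieldNormedType.Exports.

Set Implicit Arguments.
Unset Strict Implicit.
Unset Printing Implicit Defensive.

Local Open Scope classical_set_scope.
Local Open Scope ring_scope.

(** At every point [x] and in every direction [h] the difference quotients
    [s^-1 *: (f (x + s *: h) - f x)] are nondecreasing in [s > 0] up to
    [o(1) *: k], and bounded below. In a reflexive space ordered by a closed
    normal cone such a family converges in norm as [s] tends to [0^'+]: a weak
    limit point exists by reflexivity, and Hahn-Banach separation together with
    normality upgrades it to a norm limit. So the right derivative [p x h]
    exists everywhere; it is positively homogeneous, [K]-subadditive and
    Lipschitz in [h].

    Along a line, the two one-sided derivatives of a map into a separable space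
    differ at only countably many points, hence [p x h + p x (- h) = 0] on a
    dense set of [x]. For fixed [h] this set is the intersection of the open
    sets on which some second difference of step [t < 1/(n+1)] is smaller than
    [t/(n+1)], so Baire's theorem gives a dense G-delta set of [x] at which the
    equality holds for all [h] in a dense sequence, hence for all [h] by the
    Lipschitz bound. An odd
    [K]-subadditive map is additive because [K] is pointed, which makes
    [p x] linear and the derivative two-sided. *)

(** * Sublinear functionals and the Hahn-Banach theorem *)

Section SublinearFunctionals.
Variables (R : realType) (V : lmodType R).
Implicit Types (p q : V -> R) (C : set V).

Definition sublinear_functional p :=
  (forall u v, p (u + v) <= p u + p v) /\
  (forall t u, 0 <= t -> p (t *: u) = t * p u).

(** Applying the one-sided scaling bound with [t^-1] at [t *: u] gives the reverse bound. *)
Lemma sublinear_functional_le p : (forall u v, p (u + v) <= p u + p v) ->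
  p 0 <= 0 -> (forall t u, 0 < t -> p (t *: u) <= t * p u) ->
  sublinear_functional p.
Proof.
move=> pD p0 pZ; split=> // t u; rewrite le_eqVlt => /predU1P[<-|t0].
  rewrite scale0r mul0r; apply/eqP; rewrite eq_le p0 /=.
  by have := pD 0 0; rewrite addr0; lra.
apply/eqP; rewrite eq_le pZ //= -ler_pdivlMl //.
have := pZ t^-1 (t *: u); rewrite invr_gt0 => /(_ t0).
by rewrite scalerA mulVf ?gt_eqF // scale1r.
Qed.

Lemma sublinear_functional0 p : sublinear_functional p -> p 0 = 0.
Proof. by case=> _ /(_ 0 0 (lexx _)); rewrite scale0r mul0r. Qed.

Lemma sublinear_functional_ge p u : sublinear_functional p -> - p (- u) <= p u.
Proof.
move=> sp; have := sp.1 u (- u).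
by rewrite subrr (sublinear_functional0 sp); lra.
Qed.

Definition convex_subset C := forall c c' t,
  C c -> C c' -> 0 <= t -> t <= 1 -> C (t *: c + (1 - t) *: c').

Lemma convex_subset_comb C c c' s t : convex_subset C -> C c -> C c' ->
  0 <= s -> 0 <= t -> exists2 c'', C c'' & s *: c + t *: c' = (s + t) *: c''.
Proof.
move=> cC Cc Cc' s0 t0; have [st0|st0] := leP (s + t) 0.
  have -> : s = 0 by lra.
  have -> : t = 0 by lra.
  by exists c => //; rewrite addr0 !scale0r addr0.
exists ((s / (s + t)) *: c + (1 - s / (s + t)) *: c').
  apply: cC => //; first by rewrite divr_ge0 // ltW.
  by rewrite ler_pdivrMr // mul1r lerDl.
rewrite scalerDr !scalerA; congr (_ *: _ + _ *: _); field; lra.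
Qed.

(** The infimum of [p (u + t *: c) - t * d] over [t >= 0] and [c] in [C] works. It is bounded below
    by [- p (- u)] because [d <= p c], convexity of [C] makes it subadditive, and [t = 1] at
    [u = - c] gives the last claim. With [C] a singleton this drives Hahn-Banach; with [C] a
    translate of a convex set it gives separation. *)
Lemma sublinear_functional_lower p C d : sublinear_functional p ->
  C !=set0 -> convex_subset C -> (forall c, C c -> d <= p c) ->
  exists q, [/\ sublinear_functional q, forall u, q u <= p u &
    forall c, C c -> q (- c) <= - d].
Proof.
move=> sp [c0 Cc0] cC dp.
pose E u := [set r | exists2 tc : R * V, 0 <= tc.1 /\ C tc.2 &
  r = p (u + tc.1 *: tc.2) - tc.1 * d].
pose q u := inf (E u).
have Elb u : lbound (E u) (- p (- u)).
  move=> _ [[t c] /= [t0 Cc] ->].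
  have := sp.1 (u + t *: c) (- u); rewrite addrAC subrr add0r sp.2 //.
  have := ler_wpM2l t0 (dp _ Cc); lra.
have qE u t c : 0 <= t -> C c -> q u <= p (u + t *: c) - t * d.
  by move=> t0 Cc; apply: ge_inf; [exists (- p (- u)); exact: Elb|
    exists (t, c)].
have q_ge u m : (forall t c, 0 <= t -> C c -> m <= p (u + t *: c) - t * d) ->
    m <= q u.
  move=> H; apply: lb_le_inf.
    by exists (p (u + 0 *: c0) - 0 * d), (0, c0).
  by move=> _ [[t c] /= [t0 Cc] ->]; exact: H.
have qp u : q u <= p u.
  by have := qE u 0 c0 (lexx _) Cc0; rewrite scale0r addr0 mul0r subr0.
exists q; split => //.
  apply: sublinear_functional_le.
  - move=> u v; rewrite -lerBlDr; apply: (q_ge) => t c t0 Cc.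
    suff: q (u + v) - (p (u + t *: c) - t * d) <= q v by lra.
    apply: (q_ge) => s c' s0 Cc'.
    have [c'' Cc'' E''] := convex_subset_comb cC Cc Cc' t0 s0.
    have := qE (u + v) (t + s) c'' (addr_ge0 t0 s0) Cc''.
    by rewrite -E'' addrACA; have := sp.1 (u + t *: c) (v + s *: c'); lra.
  - by rewrite (le_trans (qp 0)) // (sublinear_functional0 sp).
  - move=> t u t0; rewrite -ler_pdivrMl //; apply: (q_ge) => s c s0 Cc.
    rewrite ler_pdivrMl //.
    have := qE (t *: u) (t * s) c (mulr_ge0 (ltW t0) s0) Cc.
    rewrite -scalerA -scalerDr (sp.2 _ _ (ltW t0)); lra.
move=> c Cc; have := qE (- c) 1 c ler01 Cc.
by rewrite scale1r addNr (sublinear_functional0 sp) mul1r; lra.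
Qed.

(* A sublinear functional that is minimal for the pointwise order is linear. *)
Lemma hahn_banach p : sublinear_functional p ->
  exists2 phi : V -> R^o, linear phi & forall u, phi u <= p u.
Proof.
move=> sp.
pose T := {q | sublinear_functional q /\ forall u, q u <= p u}.
(* The order is reversed, so that Zorn's lemma yields a minimal functional. *)
pose rT (q q' : T) := `[< forall u, sval q' u <= sval q u >].
have [|||] := @ZL_preorder T (exist _ p (conj sp (fun u => lexx _))) rT.
- by move=> q; apply/asboolP => u.
- move=> q r s /asboolP H1 /asboolP H2; apply/asboolP => u.
  exact: le_trans (H1 _).
- move=> A totA; have [[s0 As0]|/set0P] := pselect (A !=set0); last first.
    move/negP; rewrite negbK => /eqP ->.
    by exists (exist _ p (conj sp (fun u => lexx _))).
  pose q u := inf [set sval s u | s in A].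
  have lbA u : lbound [set sval s u | s in A] (- p (- u)).
    move=> _ [[s [ss sp']] As <-] /=.
    by apply: le_trans (sublinear_functional_ge u ss); rewrite lerN2.
  have qs u s : A s -> q u <= sval s u.
    by move=> As; apply: ge_inf; [exists (- p (- u))|exists s].
  have q_ge u m : (forall s, A s -> m <= sval s u) -> m <= q u.
    move=> H; apply: lb_le_inf; first by exists (sval s0 u), s0.
    by move=> _ [s As <-]; exact: H.
  have sq : sublinear_functional q.
    apply: sublinear_functional_le.
    + move=> u v; rewrite -lerBlDr; apply: (q_ge) => s As.
      suff: q (u + v) - sval s u <= q v by lra.
      apply: (q_ge) => t At; rewrite lerBlDl.
      (* The smaller of [s] and [t] serves for both summands. *)
      have [/asboolP H|/asboolP H] := totA _ _ As At.
        apply: le_trans (qs _ _ At) _; apply: le_trans ((svalP t).1.1 u v) _.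
        by rewrite lerD2r.
      apply: le_trans (qs _ _ As) _; apply: le_trans ((svalP s).1.1 u v) _.
      by rewrite lerD2l.
    + rewrite (le_trans (qs _ _ As0)) //.
      by rewrite (sublinear_functional0 (svalP s0).1).
    + move=> t u t0; rewrite -ler_pdivrMl //; apply: (q_ge) => s As.
      by rewrite ler_pdivrMl // -((svalP s).1.2 _ _ (ltW t0)) qs.
  have qp u : q u <= p u by exact: le_trans (qs _ _ As0) ((svalP s0).2 u).
  by exists (exist _ q (conj sq qp)) => s As; apply/asboolP => u; exact: qs.
move=> [q [sq qp]] qmin; exists q => //.
have qD u v : q (u + v) = q u + q v.
  apply/eqP; rewrite eq_le sq.1 /=.
  (* Lowering [q] at [v] gives [r <= q] with [r (- v) <= - q v]. Minimality forces [q <= r], so [q u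
     <= r (u + v) + r (- v) <= q (u + v) - q v]. *)
  have [||_ ->|r [sr rq rv]] := @sublinear_functional_lower q [set v] (q v) sq.
  - by exists v.
  - by move=> _ _ t -> -> _ _; rewrite -scalerDl addrC subrK scale1r.
  - by [].
  have rp w : r w <= p w by exact: le_trans (qp w).
  have /asboolP/= H := qmin (exist _ r (conj sr rp)) (introT (asboolP _) rq).
  have := H u; have := sr.1 (u + v) (- v); rewrite addrK.
  by have := rq (u + v); have := rv v erefl; lra.
have qN u : q (- u) = - q u.
  by have := qD u (- u); rewrite subrr (sublinear_functional0 sq); lra.
move=> a u v; rewrite qD; congr (_ + _).
have [a0|a0] := leP 0 a; first exact: sq.2.
rewrite -[a]opprK scaleNr qN sq.2 ?oppr_ge0 ?ltW //.
by rewrite /GRing.scale/= !mulNr !opprK.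
Qed.

End SublinearFunctionals.

(** * Separation of convex sets and weak limits along ultrafilters *)

Section WeakLimits.
Variables (R : realType) (Y : normedModType R).

Lemma dual_space_norm_le (phi : Y -> R^o) :
  linear phi -> (forall u, phi u <= `|u|) -> dual_space phi.
Proof.
move=> lphi le_phi; split=> //.
pose L : {linear Y -> R^o} :=
  HB.pack phi (GRing.isLinear.Build _ _ _ _ phi lphi).
apply: (@bounded_linear_continuous _ _ _ L); apply/bounded_funP => r.
exists r => x xr; apply: le_trans xr; rewrite ler_norml le_phi andbT.
by have := le_phi (- x);
  rewrite (raddfN L x : phi (- x) = - phi x) normrN lerNl.
Qed.

Lemma dual_space_norm (phi : Y -> R^o) (y : Y) (M : R) :
  dual_space phi -> 0 < M -> `|y| <= M -> `|phi y| <= M * dual_norm phi.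
Proof.
move=> [lphi cphi] M0 yM.
pose L : {linear Y -> R^o} :=
  HB.pack phi (GRing.isLinear.Build _ _ _ _ phi lphi).
have /bounded_funP/(_ 1)[B LB] := (linear_bounded_continuous L).2 cphi.
rewrite -ler_pdivrMl //.
have -> : M^-1 * `|phi y| = `|phi (M^-1 *: y)|.
  rewrite (linearZ_LR L _ y : phi (M^-1 *: y) = M^-1 * phi y).
  by rewrite normrM gtr0_norm ?invr_gt0.
apply: ub_le_sup; first by exists B => _ [z z1 <-]; exact: LB.
exists (M^-1 *: y) => //=.
by rewrite normrZ gtr0_norm ?invr_gt0 // ler_pdivrMl // mulr1.
Qed.

(** The norm is at least [d] on the translate of [C] by [- y]. Lowering the norm there and taking a
    linear minorant gives the functional. *)
Lemma convex_separation (C : set Y) (y : Y) (d : R) :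
  C !=set0 -> convex_subset C -> (forall c, C c -> d <= `|c - y|) ->
  exists2 phi, dual_space phi & forall c, C c -> phi y + d <= phi c.
Proof.
move=> [c0 Cc0] cC dC.
have snorm : sublinear_functional (fun u : Y => `|u|).
  by split=> [u v|t u t0]; [exact: ler_normD|rewrite normrZ ger0_norm].
have [||_ [c Cc <-]|q [sq qle qC]] :=
    @sublinear_functional_lower _ _ _ [set c - y | c in C] d snorm.
- by exists (c0 - y), c0.
- move=> _ _ t [c Cc <-] [c' Cc' <-] t0 t1.
  exists (t *: c + (1 - t) *: c'); first exact: cC.
  by rewrite !scalerBr addrACA -opprD -scalerDl subrKC scale1r.
- exact: dC.
have [phi lphi phile] := hahn_banach sq.
exists phi; first by apply: dual_space_norm_le => // u; exact: le_trans (qle u).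
move=> c Cc.
pose L : {linear Y -> R^o} :=
  HB.pack phi (GRing.isLinear.Build _ _ _ _ phi lphi).
have : phi (- (c - y)) <= - d by apply: le_trans (phile _) (qC _ _); exists c.
by rewrite opprB (raddfB L y c : phi (y - c) = phi y - phi c); lra.
Qed.

(** A compact segment provides a cluster point, and an ultrafilter converges to each of its cluster
    points. *)
Lemma ultra_bounded_cvg (T : Type) (G : set_system T) (u : T -> R) (M : R) :
  UltraFilter G -> (\forall t \near G, `|u t| <= M) ->
  cvg (u @ G).
Proof.
move=> UG uM; have PG := @ultra_proper _ _ UG.
have [|l [_ clu]] := @segment_compact R (- M) M (u @ G) _.
  by near do rewrite /= in_itv /= -ler_norml.
apply/cvg_ex; exists l => B lB.
have [//|nGB] := in_ultra_setVsetC (u @^-1` B) UG.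
by have [z [nBz Bz]] := clu (~` B) B nGB lB.
Unshelve. all: by end_near. Qed.

(** The limits of [phi (q t)] form a bounded linear functional of [phi] on the dual, which
    reflexivity represents by a point. *)
Lemma reflexive_ultra_weak_cvg (T : Type) (G : set_system T) (q : T -> Y)
    (M : R) : reflexive_space Y -> UltraFilter G ->
  (\forall t \near G, `|q t| <= M) ->
  exists y, forall phi, dual_space phi -> phi (q t) @[t --> G] --> phi y.
Proof.
move=> reflY UG qM; have PG := @ultra_proper _ _ UG.
(* A positive bound is needed to rescale into the unit ball. *)
pose M' := Num.max M 1.
have M'0 : 0 < M' by rewrite lt_max ltr01 orbT.
have phiM phi : dual_space phi ->
    \forall t \near G, `|phi (q t)| <= M' * dual_norm phi.
  move=> dphi; near=> t; apply: dual_space_norm => //.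
  by rewrite le_max; apply/orP; left; near: t.
have phic phi : dual_space phi -> cvg (phi (q t) @[t --> G]).
  by move=> dphi; exact: ultra_bounded_cvg (phiM _ dphi).
have [|y yP] := reflY (fun phi => lim (phi (q t) @[t --> G])).
  split=> [a phi psi dphi dpsi|].
    apply: cvg_lim => //; apply: cvgD; last exact: phic.
    by apply: cvgZl_tmp; exact: phic.
  exists M' => phi dphi; rewrite ler_norml; apply/andP; split.
    apply: (cvgr_to_ge (phic _ dphi)).
    by apply: filterS (phiM _ dphi) => t; rewrite ler_norml => /andP[].
  apply: (cvgr_to_le (phic _ dphi)).
  by apply: filterS (phiM _ dphi) => t; rewrite ler_norml => /andP[].
by exists y => phi dphi; rewrite -yP //; exact: phic.
Unshelve. all: by end_near. Qed.

End WeakLimits.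

(** * The order of a closed normal cone *)

Section ConeOrder.
Variables (R : realType) (Y : normedModType R) (K : set Y).
Hypothesis coneK : convex_cone K.
Implicit Types (x y z w : Y).

Lemma cone_le_trans x y z : cone_le K x y -> cone_le K y z -> cone_le K x z.
Proof.
by rewrite /cone_le => xy yz; rewrite -(subrK y z) -addrA; exact: coneK.1.
Qed.

Lemma cone_leD x y z w :
  cone_le K x y -> cone_le K z w -> cone_le K (x + z) (y + w).
Proof. by rewrite /cone_le opprD addrACA; exact: coneK.1. Qed.

Lemma cone_leZ t x y : 0 <= t -> cone_le K x y -> cone_le K (t *: x) (t *: y).
Proof. by rewrite /cone_le -scalerBr; exact: coneK.2. Qed.

Lemma cone_leD2r x y z : cone_le K (x + z) (y + z) <-> cone_le K x y.
Proof. by rewrite /cone_le [x + z]addrC addrKA. Qed.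

Lemma cone_leBlDr x y z : cone_le K (x - z) y <-> cone_le K x (y + z).
Proof. by rewrite /cone_le opprB addrA. Qed.

Lemma cone_leN x y : cone_le K (- x) (- y) <-> cone_le K y x.
Proof. by rewrite /cone_le opprK addrC. Qed.

Lemma cone_le_refl x : K !=set0 -> cone_le K x x.
Proof.
by move=> [y Ky]; rewrite /cone_le subrr -(scale0r y); exact: coneK.2.
Qed.

Lemma normal_cone_squeeze (gamma : R) a b c :
  (forall x y, cone_le K 0 x -> cone_le K x y -> `|x| <= gamma * `|y|) ->
  cone_le K a b -> cone_le K b c -> `|b - a| <= gamma * `|c - a|.
Proof.
move=> nK ab bc; apply: nK; first by rewrite /cone_le subr0.
exact/cone_leD2r.
Qed.

Lemma normal_cone_antisym x y :
  normal_cone K -> cone_le K x y -> cone_le K y x -> x = y.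
Proof.
move=> [g g0 nK] xy yx; apply/esym/eqP; rewrite -subr_eq0 -normr_le0.
by have := normal_cone_squeeze nK xy yx; rewrite subrr normr0 mulr0.
Qed.

Lemma cone_le_cvg (T : Type) (F : set_system T) {FF : ProperFilter F}
    (u v : T -> Y) a b : closed K -> u @ F --> a -> v @ F --> b ->
  (\forall t \near F, cone_le K (u t) (v t)) -> cone_le K a b.
Proof.
move=> clK ua vb uv; apply: (closed_cvg K clK uv).
exact: cvgB.
Qed.

Lemma convex_subset_cone : convex_subset K.
Proof.
by move=> x y t Kx Ky t0 t1; apply: coneK.1; apply: coneK.2 => //; lra.
Qed.

Lemma convex_combB (t : R) x y z :
  t *: (x + z) + (1 - t) *: (y + z) = t *: x + (1 - t) *: y + z.
Proof. by rewrite !scalerDr addrACA -scalerDl subrKC scale1r. Qed.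

End ConeOrder.

(** Mazur's argument: if [y] had distance at least [e > 0] from [C], a separating functional would
    be at least [phi y + e] on [C], hence also in the limit. *)
Lemma weak_limit_convex (R : realType) (Y : normedModType R) (T : Type)
    (G : set_system T) (q : T -> Y) (y : Y) (C : set Y) :
  ProperFilter G -> convex_subset C -> (\forall t \near G, C (q t)) ->
  (forall phi, dual_space phi -> phi (q t) @[t --> G] --> phi y) ->
  closure C y.
Proof.
move=> PG cC qC qy; apply: contrapT => nC.
have [e e0 eC] : exists2 e : R, 0 < e & forall c, C c -> e <= `|c - y|.
  apply: contrapT => H; apply: nC => B /nbhs_normP[e /= e0 eB].
  apply: contrapT => nCB; apply: H; exists e => // c Cc.
  rewrite leNgt; apply/negP => ce; apply: nCB; exists c; split => //.
  by apply: eB; rewrite /= distrC.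
have [t Ct] := filter_ex qC.
have [phi dphi phiC] := convex_separation (ex_intro _ _ Ct) cC eC.
suff : phi y + e <= phi y by lra.
by apply: (cvgr_to_ge (qy _ dphi)); apply: filterS qC => s; exact: phiC.
Qed.

(** * Norm convergence of almost monotone families *)

Section AlmostMonotone.
Variables (R : realType) (Y : normedModType R) (K : set Y) (k : Y).
Hypotheses (reflY : reflexive_space Y) (coneK : convex_cone K).
Hypotheses (closedK : closed K) (normalK : normal_cone K).

(* A weak limit [y] along an ultrafilter is a norm limit: by separation, [y] is
   a lower bound of [q] and is approximated in norm by eventual upper bounds
   of [q], all up to a multiple of [k]. *)
Lemma almost_monotone_cvg (T : Type) (F : set_system T) (q : T -> Y) (c : Y) :
  ProperFilter F ->
  (forall e, 0 < e ->
    \forall t \near F, \forall s \near F, cone_le K (q s) (q t + e *: k)) ->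
  (\forall s \near F, cone_le K c (q s)) ->
  cvg (q @ F).
Proof.
move=> PF qmono qc; have [g g0 nK] := normalK.
have [t0 qt0] := filter_ex (qmono 1 ltr01).
(* Eventually [q s] lies between [c] and [q t0 + 1 *: k], so normality bounds it. *)
pose M := `|c| + g * `|q t0 + 1 *: k - c|.
have qM : \forall s \near F, `|q s| <= M.
  near=> s; rewrite -(subrKC c (q s)) (le_trans (ler_normD _ _)) // lerD2l.
  by apply: (normal_cone_squeeze nK); near: s.
have [G [UG FG]] := ultraFilterLemma PF.
have PG := @ultra_proper _ _ UG.
have [y qy] := reflexive_ultra_weak_cvg reflY UG (FG _ qM).
have ylow e : 0 < e -> \forall t \near F, cone_le K y (q t + e *: k).
  move=> /qmono; apply: filterS => t qt.
  have clK : closed [set z | cone_le K z (q t + e *: k)].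
    apply: (@preimage_closed _ _ (fun z => q t + e *: k - z) K) => // z _.
    by apply: cvgB; [exact: cvg_cst|exact: cvg_id].
  apply: clK.
  apply: weak_limit_convex qy => //; last exact: FG qt.
  move=> u v l Ku Kv l0 l1; rewrite /cone_le /=.
  have -> : q t + e *: k - (l *: u + (1 - l) *: v) =
      l *: (q t + e *: k - u) + (1 - l) *: (q t + e *: k - v).
    rewrite ![q t + e *: k - _]addrC convex_combB.
    by rewrite !scalerN -opprD.
  exact: (convex_subset_cone coneK).
have yup e : 0 < e ->
    closure [set z | \forall s \near F, cone_le K (q s) (z + e *: k)] y.
  move=> e0; apply: weak_limit_convex qy => //; last exact/FG/qmono.
  move=> u v l Ku Kv l0 l1 /=; near=> s.
  have -> : q s = l *: q s + (1 - l) *: q s.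
    by rewrite -scalerDl subrKC scale1r.
  rewrite -convex_combB.
  by apply: (cone_leD coneK); apply: (cone_leZ coneK); [|near: s|lra|near: s].
apply/cvg_ex; exists y; apply/cvgrPdist_le => eps eps0.
(* The choice makes [g * (2 * e1) + 2 * e1 = eps] and [2 * e * |k| <= e1]. The [+ 1] next to the
   norm of [k] keeps the denominator positive. *)
pose e1 := eps / (2 * (g + 1)); pose e := e1 / (2 * (`|k| + 1)).
have k0 := normr_ge0 k.
have e10 : 0 < e1 by rewrite divr_gt0 //; lra.
have e0 : 0 < e by rewrite divr_gt0 //; lra.
have ek : 2 * e * `|k| <= e1.
  rewrite -[leRHS](_ : 2 * e * (`|k| + 1) = _); last by rewrite /e; field; lra.
  by rewrite ler_wpM2l //; lra.
have [z [/= zup zy]] := yup e e0 _ (nbhsx_ballx y e1 e10).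
near=> s.
have ys : cone_le K y (q s + e *: k) by near: s; exact: ylow.
have sz : cone_le K (q s + e *: k) (z + e *: k + e *: k).
  by apply/cone_leD2r; near: s.
have := normal_cone_squeeze nK ys sz.
have : `|z + e *: k + e *: k - y| <= e1 + e1.
  rewrite -(addrA z) addrAC (le_trans (ler_normD _ _)) // lerD //.
    by move: zy; rewrite -ball_normE /= distrC => /ltW.
  by rewrite -scalerDl normrZ ger0_norm; lra.
move=> /(ler_wpM2l (ltW g0)) H /le_trans/(_ H) {}H.
rewrite distrC -(addrK (e *: k) (q s - y)).
rewrite (le_trans (ler_normB _ _)) // addrAC normrZ gtr0_norm //.
have : eps = g * (e1 + e1) + (e1 + e1) by rewrite /e1; field; lra.
lra.
Unshelve. all: by end_near. Qed.

End AlmostMonotone.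

(** * One-sided derivatives along a line *)

Lemma separable_seq (T : ptopologicalType) : separable_space T ->
  exists d : nat -> T,
    forall U : set T, open U -> U !=set0 -> exists n, U (d n).
Proof.
move=> [D /countable_injP[phi phi_inj] dD].
exists ('pinv_(fun=> point) D phi) => U oU U0.
have [y [Uy Dy]] := dD U U0 oU.
by exists (phi y); rewrite pinvKV // inE.
Qed.

Section OneSidedDerivatives.
Variables (R : realType) (Y : normedModType R).

Lemma right_limit_seq (u : R -> Y) (l : Y) (e : R) : 0 < e ->
  u s @[s --> 0^'+] --> l ->
  exists n : nat, forall s, 0 < s -> s < n.+1%:R^-1 -> `|l - u s| < e.
Proof.
move=> e0 /cvgrPdist_lt/(_ e e0)[r /= r0 H].
have [n] := ltr_add_invr r0; rewrite add0r => nr.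
exists n => s s0 sn; apply: H => //=.
by rewrite sub0r normrN gtr0_norm // (lt_trans sn).
Qed.

(* If both one-sided derivatives of [g] at [t] are recorded up to a fraction of
   their distance, together with a radius [1/(n+1)] on which the difference
   quotients have that accuracy, then two points with the same record are at
   distance at least [1/(n+1)]: otherwise the quotient between them would be
   close to both derivatives. So the points where the derivatives differ are
   countably many. *)
Lemma one_sided_derivatives_meet (g p m : R -> Y) (a b : R) :
  separable_space Y -> a < b ->
  (forall t, a < t -> t < b ->
    s^-1 *: (g (t + s) - g t) @[s --> 0^'+] --> p t) ->
  (forall t, a < t -> t < b ->
    s^-1 *: (g t - g (t - s)) @[s --> 0^'+] --> m t) ->
  exists t, [/\ a < t, t < b & p t = m t].
Proof.
move=> sepY ab gp gm; apply: contrapT => nex.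
have {nex} pm t : a < t -> t < b -> 0 < `|p t - m t|.
  move=> at_ tb; rewrite normr_gt0 subr_eq0; apply/eqP => E.
  by apply: nex; exists t.
have [d dd] := separable_seq sepY.
have appr y e : 0 < e -> exists i, `|y - d i| < e.
  move=> e0; have [||i di] := dd (ball y e).
    exact: ball_open.
    by exists y; exact: ballxx.
  by exists i; move: di; rewrite -ball_normE.
pose P t (c : nat * nat * nat) := forall s, 0 < s -> s < c.2.+1%:R^-1 ->
  2 * `|s^-1 *: (g (t + s) - g t) - d c.1.1| < `|d c.1.1 - d c.1.2| /\
  2 * `|s^-1 *: (g t - g (t - s)) - d c.1.2| < `|d c.1.1 - d c.1.2|.
have exP t : exists c, a < t -> t < b -> P t c.
  have [at_|] := boolP (a < t); last by exists (0, 0, 0)%N.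
  have [tb|] := boolP (t < b); last by exists (0, 0, 0)%N.
  (* The quotients will lie within [2 * e] of [d i] and [d j], which are at least [6 * e] apart. *)
  pose e := `|p t - m t| / 8.
  have e0 : 0 < e by rewrite divr_gt0 // pm.
  have [i pi] := appr (p t) e e0; have [j mj] := appr (m t) e e0.
  have [n1 pn] := right_limit_seq e0 (gp t at_ tb).
  have [n2 mn] := right_limit_seq e0 (gm t at_ tb).
  exists (i, j, maxn n1 n2) => _ _ s s0 /= sn.
  have dij : `|p t - m t| <= e + `|d i - d j| + e.
    have := ler_distD (d i) (p t) (m t); have := ler_distD (d j) (d i) (m t).
    by rewrite (distrC (d j)); lra.
  have e8 : `|p t - m t| = 8 * e by rewrite /e; field.
  have lt_s (k : nat) : (k <= maxn n1 n2)%N -> s < k.+1%:R^-1.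
    move=> kn; apply: lt_le_trans sn _.
    by rewrite lef_pV2 ?posrE // ler_nat.
  split.
    have := pn s s0 (lt_s _ (leq_maxl _ _)); rewrite distrC.
    have := ler_distD (p t) (s^-1 *: (g (t + s) - g t)) (d i); lra.
  have := mn s s0 (lt_s _ (leq_maxr _ _)); rewrite distrC.
  have := ler_distD (m t) (s^-1 *: (g t - g (t - s))) (d j); lra.
have [c cP] := choice exP.
(* The floor records a cell of length [1/(n+1)], so points with equal codes are closer than their
   common radius. *)
pose code t := (c t, Num.floor (t * (c t).2.+1%:R)).
have sep t t' : a < t -> t < t' -> t' < b -> code t != code t'.
  move=> at_ tt tb; apply/eqP => -[Ec Ef].
  have n0 : 0 < (c t).2.+1%:R :> R by [].
  have s0 : 0 < t' - t by rewrite subr_gt0.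
  have sn : t' - t < (c t).2.+1%:R^-1.
    rewrite -[ltRHS]mulr1 ltr_pdivlMl // mulrC mulrBl.
    have := floor_le (t * (c t).2.+1%:R).
    have := floorD1_gt (t' * (c t').2.+1%:R).
    by rewrite -Ef -Ec intrD; lra.
  (* With step [t' - t], the forward quotient at [t] is the backward quotient at [t']. It cannot be
     within half the distance of both approximants. *)
  have [H1 _] := cP t at_ (lt_trans tt tb) _ s0 sn.
  have [] := cP t' (lt_trans at_ tt) tb (t' - t); rewrite -?Ec // => _ H2.
  move: H1 H2; rewrite subrKC subKr => H1 H2.
  have := ler_distD ((t' - t)^-1 *: (g t' - g t)) (d (c t).1.1) (d (c t).1.2).
  by rewrite [`|d _ - (_ *: _)|]distrC; lra.
(* The code is injective on the interval, which would then be countable and of Lebesgue measure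
   zero. *)
have : countable `]a, b[%classic.
  apply/countable_injP; exists (fun t => pickle (code t)) => t t'.
  rewrite !inE /= !in_itv /= => /andP[at_ tb] /andP[at' tb'].
  move=> /(pcan_inj pickleK) E; case: (ltgtP t t') => // tt.
    by have := sep _ _ at_ tt tb'; rewrite E eqxx.
  by have := sep _ _ at' tt tb; rewrite E eqxx.
move=> /countable_lebesgue_measure0; rewrite lebesgue_measure_itv /= lte_fin ab.
by move=> /eqP; rewrite -EFinB eqe subr_eq0 => /eqP E; rewrite E ltxx in ab.
Qed.

End OneSidedDerivatives.

Lemma right_limit_scale (R : realType) (Y : normedModType R) (u : R -> Y)
    (l : Y) (a : R) : 0 < a -> u s @[s --> 0^'+] --> l ->
  u (a * s) @[s --> 0^'+] --> l.
Proof.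
move=> a0 ul; apply: cvg_comp ul => B [r /= r0 rB].
exists (r / a) => /=; first exact: divr_gt0.
move=> s /=; rewrite sub0r normrN => sr s0; apply: rB; rewrite /= ?mulr_gt0 //.
by rewrite sub0r normrN normrM gtr0_norm // mulrC -ltr_pdivlMr.
Qed.

Lemma paraconvexity_modulus_small (R : realType) (alpha : R -> R) (m e : R) :
  paraconvexity_modulus alpha -> 0 <= m -> 0 < e ->
  \forall t \near 0^'+, alpha (t * m) <= e * t.
Proof.
move=> [alpha_ge0 alpha_mono alpha0] m0 e0.
have m1 : 0 < m + 1 by lra.
have /cvgrPdist_lt/(_ (e / (m + 1)) (divr_gt0 e0 m1))[r /= r0 H] := alpha0.
near=> t; have t0 : 0 < t by near: t; exact: nbhs_right_gt.
have tm0 : 0 < t * (m + 1) by exact: mulr_gt0.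
have tr : t < r / (m + 1) by near: t; apply: nbhs_right_lt; exact: divr_gt0.
(* Monotonicity replaces [m] by [m + 1], which is positive even when [m = 0]. *)
apply: (@le_trans _ _ (alpha (t * (m + 1)))).
  apply: alpha_mono; first exact: mulr_ge0 (ltW _) _.
  by rewrite ler_wpM2l // ?ltW //; lra.
have := H (t * (m + 1)); rewrite /= !sub0r !normrN gtr0_norm // -ltr_pdivlMr //.
move=> /(_ tr tm0); rewrite ltr_norml => /andP[_ /ltW].
rewrite ler_pdivrMr // => /le_trans -> //.
by rewrite mulrCA divfK ?gt_eqF // mulrC.
Unshelve. all: by end_near. Qed.

(** * Difference quotients of a paraconvex map *)

Section Paraconvex.
Variables (R : realType) (X Y : normedModType R).
Variables (alpha : R -> R) (K : set Y) (k : Y) (C : R) (f : X -> Y).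
Hypotheses (alphaP : paraconvexity_modulus alpha).
Hypotheses (coneK : convex_cone K) (Kk : K k) (C0 : 0 < C).
Hypothesis f_paraconvex : forall (x y : X) (l : R), 0 <= l -> l <= 1 ->
  cone_le K (f (l *: x + (1 - l) *: y))
    (l *: f x + (1 - l) *: f y
     + (C * Num.min l (1 - l) * alpha `|x - y|) *: k).

Definition difference_quotient (x h : X) (s : R) :=
  s^-1 *: (f (x + s *: h) - f x).

Local Notation q := difference_quotient.

Lemma difference_quotientZ x h a s : a != 0 ->
  q x (a *: h) s = a *: q x h (a * s).
Proof.
by move=> a0; rewrite /q !scalerA invfM mulrA mulfV // mul1r [s * a]mulrC.
Qed.

Lemma cone_le_addk (a b : R) (y : Y) : a <= b ->
  cone_le K (y + a *: k) (y + b *: k).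
Proof.
move=> ab; rewrite /cone_le opprD addrACA subrr add0r -scalerBl.
by apply: coneK.2 => //; rewrite subr_ge0.
Qed.

(** The point [x + s *: h] is the combination of [x + t *: h] and [x] with weight [s / t]. Since the
    minimum in the error is at most [s / t], division by [s] leaves an error depending on [t]
    only. *)
Lemma difference_quotient_mono x h s t : 0 < s -> s <= t ->
  cone_le K (q x h s) (q x h t + (C * (alpha (t * `|h|) / t)) *: k).
Proof.
move=> s0 st; have t0 : 0 < t by exact: lt_le_trans st.
have [alpha_ge0 _ _] := alphaP.
have l0 : 0 <= s / t by rewrite divr_ge0 // ltW.
have l1 : s / t <= 1 by rewrite ler_pdivrMr // mul1r.
pose D := f (x + t *: h) - f x; pose c := C * (s / t) * alpha (t * `|h|).
have H : cone_le K (f (x + s *: h) - f x) ((s / t) *: D + c *: k).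
  apply/cone_leBlDr; rewrite addrAC.
  have -> : x + s *: h = (s / t) *: (x + t *: h) + (1 - s / t) *: x.
    rewrite scalerDr addrAC -scalerDl subrKC scale1r scalerA.
    by rewrite divfK ?gt_eqF.
  have -> : (s / t) *: D + f x = (s / t) *: f (x + t *: h) + (1 - s / t) *: f x.
    by rewrite scalerBl scale1r scalerBr addrAC addrA.
  apply: (cone_le_trans coneK) (f_paraconvex _ _ l0 l1) _.
  rewrite [x + _ - x]addrC addKr normrZ gtr0_norm //.
  apply: cone_le_addk; rewrite /c ler_wpM2r //.
    by apply: alpha_ge0; rewrite mulr_ge0 // ltW.
  by rewrite ler_wpM2l ?(ltW C0) // ge_min lexx.
have sV0 : 0 <= s^-1 by rewrite invr_ge0 ltW.
have := cone_leZ coneK sV0 H; rewrite [_ *: (_ *: _ + _)]scalerDr !scalerA.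
have -> : s^-1 * (s / t) = t^-1 by rewrite mulKf ?gt_eqF.
congr (cone_le K _ (_ + _ *: k)).
by rewrite /c; field; rewrite !gt_eqF.
Qed.

(** This is paraconvexity at the midpoint of [x + s *: h1] and [x + s *: h2]. *)
Lemma difference_quotient_mid x h1 h2 s : 0 < s ->
  cone_le K (q x (h1 + h2) (s / 2))
    (q x h1 s + q x h2 s + (C * (alpha (s * `|h1 - h2|) / s)) *: k).
Proof.
move=> s0.
pose c := C * 2^-1 * alpha (s * `|h1 - h2|).
have H : cone_le K (f (x + (s / 2) *: (h1 + h2)) - f x)
    (2^-1 *: (f (x + s *: h1) - f x + (f (x + s *: h2) - f x)) + c *: k).
  apply/cone_leBlDr; rewrite addrAC.
  have half : 1 - 2^-1 = 2^-1 :> R by field.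
  have halfD (V : lmodType R) (v : V) : 2^-1 *: v + 2^-1 *: v = v.
    by rewrite -scalerDl -[X in X + _]half subrK scale1r.
  have -> : x + (s / 2) *: (h1 + h2) =
      2^-1 *: (x + s *: h1) + (1 - 2^-1) *: (x + s *: h2).
    by rewrite half !scalerDr addrACA halfD !scalerA mulrC.
  have -> : 2^-1 *: (f (x + s *: h1) - f x + (f (x + s *: h2) - f x)) + f x =
      2^-1 *: f (x + s *: h1) + (1 - 2^-1) *: f (x + s *: h2).
    rewrite half addrACA -opprD scalerDr scalerN [_ *: (f x + _)]scalerDr.
    by rewrite halfD subrK scalerDr.
  have dist : `|x + s *: h1 - (x + s *: h2)| = s * `|h1 - h2|.
    by rewrite opprD addrACA subrr add0r -scalerBr normrZ gtr0_norm.
  have := f_paraconvex (x + s *: h1) (x + s *: h2) (l := 2^-1).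
  by rewrite dist half minxx; apply; lra.
have sV0 : 0 <= (s / 2)^-1 by rewrite invr_ge0 divr_ge0 // ltW.
have := cone_leZ coneK sV0 H; rewrite [_ *: (_ *: _ + _)]scalerDr !scalerA.
have -> : (s / 2)^-1 * 2^-1 = s^-1 by field; rewrite gt_eqF.
rewrite [s^-1 *: (_ + _)]scalerDr.
congr (cone_le K _ (_ + _ *: k)).
by rewrite /c; field; rewrite gt_eqF.
Qed.

Lemma modulus_quotient_small m e : 0 <= m -> 0 < e ->
  \forall t \near 0^'+, C * (alpha (t * m) / t) <= e.
Proof.
move=> m0 e0; near=> t.
have t0 : 0 < t by near: t; exact: nbhs_right_gt.
rewrite -ler_pdivlMl // ler_pdivrMr //; near: t.
by apply: paraconvexity_modulus_small; rewrite // mulr_gt0 ?invr_gt0.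
Unshelve. all: by end_near. Qed.

Lemma difference_quotient_almost_mono x h e : 0 < e ->
  \forall t \near 0^'+, \forall s \near 0^'+,
    cone_le K (q x h s) (q x h t + e *: k).
Proof.
move=> e0; near=> t; near=> s.
have s0 : 0 < s by near: s; exact: nbhs_right_gt.
have st : s <= t.
  by near: s; apply: nbhs_right_le; near: t; exact: nbhs_right_gt.
apply: (cone_le_trans coneK) (difference_quotient_mono x h s0 st) _.
by apply: cone_le_addk; near: t; exact: modulus_quotient_small.
Unshelve. all: by end_near. Qed.

Lemma difference_quotient_subadd x h1 h2 e : 0 < e ->
  \forall s \near 0^'+,
    cone_le K (q x (h1 + h2) (s / 2)) (q x h1 s + q x h2 s + e *: k).
Proof.
move=> e0; near=> s.
have s0 : 0 < s by near: s; exact: nbhs_right_gt.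
apply: (cone_le_trans coneK) (difference_quotient_mid x h1 h2 s0) _.
by apply: cone_le_addk; near: s; exact: modulus_quotient_small.
Unshelve. all: by end_near. Qed.

Lemma difference_quotient0 x s : q x 0 s = 0.
Proof. by rewrite /q scaler0 addr0 subrr scaler0. Qed.

(** * Existence, sublinearity and Lipschitz bound of the right derivative *)

Hypotheses (reflY : reflexive_space Y) (closedK : closed K).
Hypothesis normalK : normal_cone K.

(** The lower bound comes from the opposite direction: the midpoint inequality for [h] and [- h]
    bounds [q x h s] below by [- q x (- h) s - k], and [q x (- h) s] is almost monotone. *)
Lemma difference_quotient_cvg x h : cvg (q x h s @[s --> 0^'+]).
Proof.
have /(@filter_ex _ _ (at_right_proper_filter 0))[t qt] :=
  difference_quotient_almost_mono x (- h) ltr01.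
apply: (almost_monotone_cvg (k := k) reflY coneK closedK normalK
  (c := 0 - (q x (- h) t + 1 *: k + 1 *: k))).
  by move=> e; exact: difference_quotient_almost_mono.
near=> s; apply/cone_leBlDr; rewrite addrA.
have : cone_le K 0 (q x h s + q x (- h) s + 1 *: k).
  rewrite -(difference_quotient0 x (s / 2)) -(subrr h); near: s.
  exact: difference_quotient_subadd.
move=> /(cone_le_trans coneK); apply; apply/cone_leD2r.
rewrite ![q x h s + _]addrC; apply/cone_leD2r.
by near: s.
Unshelve. all: by end_near. Qed.

Definition right_derivative x h : Y := lim (q x h s @[s --> 0^'+]).

Local Notation p := right_derivative.

Lemma right_derivativeP x h : q x h s @[s --> 0^'+] --> p x h.
Proof. exact: difference_quotient_cvg. Qed.

Lemma right_derivative0 x : p x 0 = 0.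
Proof.
apply: cvg_lim => //; under eq_fun do rewrite difference_quotient0.
exact: cvg_cst.
Qed.

Lemma right_derivativeZ x h a : 0 < a -> p x (a *: h) = a *: p x h.
Proof.
move=> a0; apply: cvg_lim => //.
under eq_fun do rewrite difference_quotientZ ?gt_eqF //.
by apply: cvgZl_tmp; apply: right_limit_scale => //; exact: right_derivativeP.
Qed.

Lemma right_derivativeD x h1 h2 : cone_le K (p x (h1 + h2)) (p x h1 + p x h2).
Proof.
(* Subadditivity is available up to [e *: k]; closedness of [K] removes this error. *)
apply: (closedK : closure K `<=` K) => B /nbhs_normP[r /= r0 rB].
pose e := r / (2 * (`|k| + 1)).
have k0 := normr_ge0 k.
have e0 : 0 < e by rewrite divr_gt0 //; lra.
have ek : `|e *: k| < r.
  rewrite normrZ gtr0_norm // (@lt_le_trans _ _ (e * (2 * (`|k| + 1)))) //.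
    by rewrite ltr_pM2l //; lra.
  by rewrite divfK // gt_eqF //; lra.
exists (p x h1 + p x h2 + e *: k - p x (h1 + h2)); split; last first.
  by apply: rB => /=; rewrite [X in _ - X]addrAC opprD addNKr normrN.
apply: (@cone_le_cvg _ _ K _ _ (at_right_proper_filter 0)
  (fun s => q x (h1 + h2) (2^-1 * s))
  (fun s => q x h1 s + q x h2 s + e *: k)) => //.
- apply: (@right_limit_scale _ _ (q x (h1 + h2))); rewrite ?invr_gt0 //.
  exact: right_derivativeP.
- by apply: cvgD; [apply: cvgD; exact: right_derivativeP|exact: cvg_cst].
- apply: filterS (difference_quotient_subadd x h1 h2 e0) => s.
  by rewrite mulrC.
Qed.

Hypothesis f_bounded : locally_vector_bounded K setT f.

(** For a unit vector, almost monotonicity compares small quotients with the one at a fixed step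
    [t], where local boundedness applies. Homogeneity gives the other directions. *)
Lemma right_derivative_le x : exists c : Y,
  forall h, cone_le K (p x h) (`|h| *: c).
Proof.
have [U [k' [oU Ux Kk' fk']]] := @f_bounded x I.
have /nbhs_normP[r /= r0 rU] := open_nbhs_nbhs (conj oU Ux).
pose t := r / 2; have t0 : 0 < t by rewrite /t; lra.
have [alpha_ge0 alpha_mono _] := alphaP.
exists (t^-1 *: (k' + k') + (C * (alpha t / t)) *: k) => h.
have [->|h0] := eqVneq h 0.
  rewrite right_derivative0 normr0 scale0r; apply: cone_le_refl => //.
  by exists k.
have nh0 : 0 < `|h| by rewrite normr_gt0.
pose v := `|h|^-1 *: h.
have nv : `|v| = 1 by rewrite normrZ normfV normr_id mulVf ?gt_eqF.
have {1}-> : h = `|h| *: v by rewrite scalerA mulfV ?gt_eqF // scale1r.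
rewrite right_derivativeZ //; apply: cone_leZ; rewrite ?normr_ge0 //.
apply: (@cone_le_cvg _ _ K _ _ (at_right_proper_filter 0)
  (q x v) (fun=> _)) => //;
  [exact: right_derivativeP|exact: cvg_cst|].
near=> s.
have s0 : 0 < s by near: s; exact: nbhs_right_gt.
have st : s <= t by near: s; exact: nbhs_right_le.
apply: (cone_le_trans coneK) (difference_quotient_mono x v s0 st) _.
rewrite nv mulr1; apply/cone_leD2r; apply: cone_leZ => //.
  by rewrite invr_ge0 ltW.
apply: cone_leD => //.
  apply: (fk' _ _).2; apply: rU => /=.
  by rewrite opprD addNKr normrN normrZ nv mulr1 gtr0_norm // /t; lra.
by have [+ _] := fk' x Ux; rewrite -cone_leN opprK.
Unshelve. all: by end_near. Qed.

(** Subadditivity bounds the change of [p x] in the order by a multiple of [c], in both directions,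
    and normality turns this into a norm bound. The summand [1] keeps [M] positive. *)
Lemma right_derivative_lipschitz x : exists2 M : R, 0 < M &
  forall h h', `|p x h - p x h'| <= M * `|h - h'|.
Proof.
have [c pc] := right_derivative_le x; have [g g0 nK] := normalK.
have c0 := normr_ge0 c.
exists (g * 2 * `|c| + `|c| + 1) => [|h h'].
  by rewrite ltr_wpDl // addr_ge0 // !mulr_ge0 // ltW.
set d := `|h - h'|; have d0 : 0 <= d by exact: normr_ge0.
have up u w : cone_le K (p x u) (p x w + `|u - w| *: c).
  rewrite -[u in p x u](subrKC w).
  apply: (cone_le_trans coneK) (right_derivativeD _ _ _) _.
  by rewrite ![p x w + _]addrC; exact/cone_leD2r.
have H1 : cone_le K (p x h') (p x h + d *: c) by rewrite /d distrC.
have H2 : cone_le K (p x h + d *: c) (p x h' + d *: c + d *: c).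
  exact/cone_leD2r.
have := normal_cone_squeeze nK H1 H2.
have -> : p x h' + d *: c + d *: c - p x h' = (2 * d) *: c.
  by rewrite -(addrA (p x h')) addrAC subrr add0r -scalerDl mulr_natl mulr2n.
rewrite normrZ ger0_norm ?mulr_ge0 // => H.
rewrite -(addrK (d *: c) (_ - _)) (le_trans (ler_normB _ _)) // addrAC.
rewrite (normrZ d) ger0_norm //.
apply: le_trans (lerD H (lexx _)) _; rewrite -subr_ge0.
have -> : (g * 2 * `|c| + `|c| + 1) * d -
  (g * (2 * d * `|c|) + d * `|c|) = d by ring.
by [].
Qed.

(** * From an odd right derivative to Gâteaux differentiability *)

Hypothesis f_cont : continuous f.

Lemma gateaux_right_derivative x :
  (forall h, p x h + p x (- h) = 0) -> gateaux_differentiable f x.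
Proof.
move=> p0.
have pN h : p x (- h) = - p x h.
  by apply/eqP; rewrite -addr_eq0 addrC p0.
have plin : linear (p x).
  have pD h1 h2 : p x (h1 + h2) = p x h1 + p x h2.
    (* The reverse inequality is subadditivity at [- h1] and [- h2], rewritten by oddness. *)
    apply: (normal_cone_antisym normalK); first exact: right_derivativeD.
    by apply/cone_leN; rewrite opprD -!pN opprD; exact: right_derivativeD.
  move=> a u v; rewrite pD; congr (_ + _).
  have [a0|a0|->] := ltgtP a 0.
  - rewrite -[in LHS](opprK a) scaleNr pN right_derivativeZ ?oppr_gt0 //.
    by rewrite scaleNr opprK.
  - exact: right_derivativeZ.
  - by rewrite !scale0r right_derivative0.
have pder h :
    (fun t => t^-1 *: ((f \o shift x) (t *: h) - f x)) @ 0^' --> p x h.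
  apply/cvgrPdist_le => e e0.
  have /cvgrPdist_le/(_ e e0)[r /= r0 rP] := @right_derivativeP x h.
  have /cvgrPdist_le/(_ e e0)[r' /= r'0 rP'] := @right_derivativeP x (- h).
  exists (Num.min r r') => /=; first by rewrite lt_min r0.
  move=> t /=; rewrite lt_min => /andP[tr tr'] t0; rewrite [_ + x]addrC.
  have [tneg|tpos|E] := ltgtP t 0.
  (* A negative step along [h] is a positive step along [- h]. *)
  - have E : p x (- h) - q x (- h) (- t) =
        - (p x h - t^-1 *: (f (x + t *: h) - f x)).
      by rewrite pN opprD /q invrN !scaleNr scalerN !opprK.
    have := rP' (- t); rewrite /= E normrN oppr_gt0 sub0r normrN -sub0r.
    by apply.
  - exact: rP.
  - by rewrite E eqxx in t0.
have DE h : 'D_h f x = p x h by exact: cvg_lim (pder h).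
split.
- by move=> h; apply/cvg_ex; exists (p x h).
- by move=> a u v; rewrite !DE plin.
- rewrite (_ : (fun h => 'D_h f x) = p x); last exact/funext.
  move=> h; have [M M0 pM] := right_derivative_lipschitz x.
  apply/cvgrPdist_le => e e0; near=> h'.
  apply: le_trans (pM _ _) _; rewrite mulrC -ler_pdivlMr //; near: h'.
  by apply: cvgr_dist_le; [exact: cvg_id|exact: divr_gt0].
Unshelve. all: by end_near. Qed.

Lemma right_derivative_opp_dense x (d : nat -> X) :
  (forall U : set X, open U -> U !=set0 -> exists n, U (d n)) ->
  (forall n, p x (d n) + p x (- d n) = 0) ->
  forall h, p x h + p x (- h) = 0.
Proof.
move=> dd d0 h; apply/eqP; rewrite -normr_le0; apply/ler_addgt0Pl => e e0.
rewrite addr0; have [M M0 pM] := right_derivative_lipschitz x.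
(* The Lipschitz bound is used twice, at [h] and at [- h]. *)
have e1 : 0 < e / (2 * M) by rewrite divr_gt0 // mulr_gt0.
have [||n dn] := dd (ball h (e / (2 * M))).
- exact: ball_open.
- by exists h; exact: ballxx.
rewrite -[X in `|X|]subr0 -(d0 n) opprD addrACA.
apply: le_trans (ler_normD _ _) _; apply: le_trans (lerD (pM _ _) (pM _ _)) _.
rewrite -opprD normrN; move: dn; rewrite -ball_normE /= => /ltW.
by rewrite ler_pdivlMr ?mulr_gt0 //; lra.
Qed.

(** * Generic differentiability in a fixed direction *)

Hypothesis sepY : separable_space Y.

(** On the line through [x], the left derivative at [t] is [- p (x + t *: h) (- h)], so the sum
    vanishes where the one-sided derivatives meet. *)
Lemma right_derivative_opp_ex x h b : 0 < b ->
  exists t, [/\ 0 < t, t < b & p (x + t *: h) h + p (x + t *: h) (- h) = 0].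
Proof.
move=> b0.
pose g t := f (x + t *: h).
have gp t : s^-1 *: (g (t + s) - g t) @[s --> 0^'+] --> p (x + t *: h) h.
  rewrite /g; under eq_fun do rewrite scalerDl addrA.
  exact: right_derivativeP.
have gm t : s^-1 *: (g t - g (t - s)) @[s --> 0^'+] --> - p (x + t *: h) (- h).
  have -> : (fun s => s^-1 *: (g t - g (t - s))) =
      (fun s => - q (x + t *: h) (- h) s).
    apply/funext => s; rewrite /g /q -scalerN opprB.
    by rewrite scalerBl scalerN addrA.
  by apply: cvgN; exact: right_derivativeP.
have [t [t0 tb E]] := one_sided_derivatives_meet sepY b0
  (fun t _ _ => gp t) (fun t _ _ => gm t).
by exists t; split=> //; rewrite E addNr.
Qed.

(** Asking for one small step rather than all of them makes this a union of open sets. Nothing is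
    lost, as the sum of the quotients converges at every point. *)
Definition almost_differentiable h n : set X :=
  \bigcup_(t in [set t : R | 0 < t /\ t < n.+1%:R^-1])
    [set x | `|q x h t + q x (- h) t| < n.+1%:R^-1].

Lemma almost_differentiable_open h n : open (almost_differentiable h n).
Proof.
apply: bigcup_open => t _.
apply: (@open_comp _ _ (fun x => `|q x h t + q x (- h) t|)
  [set r | r < n.+1%:R^-1]); last exact: open_lt.
have fs v : continuous (fun x => q x v t).
  move=> x; apply: cvgZl_tmp; apply: cvgB; last exact: f_cont.
  apply: (@continuous_comp _ _ _ (fun x => x + t *: v) f); last exact: f_cont.
  by apply: cvgD; [exact: cvg_id|exact: cvg_cst].
by move=> x _; apply: cvg_norm; apply: cvgD; exact: fs.
Qed.

Lemma right_derivative_opp_cvg x h :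
  q x h s + q x (- h) s @[s --> 0^'+] --> p x h + p x (- h).
Proof. by apply: cvgD; exact: right_derivativeP. Qed.

Lemma almost_differentiable_dense h n : dense (almost_differentiable h n).
Proof.
move=> U [x0 Ux0] oU.
have /nbhs_normP[r /= r0 rU] := open_nbhs_nbhs (conj oU Ux0).
have h0 : 0 < `|h| + 1 by rewrite ltr_wpDl.
have [t [t0 tb E]] := right_derivative_opp_ex x0 h (divr_gt0 r0 h0).
exists (x0 + t *: h); split.
  apply: rU => /=; rewrite opprD addNKr normrN normrZ gtr0_norm //.
  apply: le_lt_trans (_ : t * (`|h| + 1) < r); last by rewrite -ltr_pdivlMr.
  by rewrite ler_wpM2l ?ltW // ltrDl.
have n0 : 0 < n.+1%:R^-1 :> R by rewrite invr_gt0.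
have [m qm] := right_limit_seq n0 (@right_derivative_opp_cvg (x0 + t *: h) h).
(* One radius ensures accuracy of the limit, the other membership in the set. *)
have [s s0 sm] : exists2 s : R, 0 < s & s < Num.min m.+1%:R^-1 n.+1%:R^-1.
  exists (Num.min m.+1%:R^-1 n.+1%:R^-1 / 2).
    by rewrite divr_gt0 // lt_min n0 invr_gt0 ltr0n.
  by rewrite ltr_pdivrMr // ltr_pMr ?ltr1n // lt_min n0 invr_gt0 ltr0n.
move: sm; rewrite lt_min => /andP[sm sn]; exists s => //=.
by have := qm s s0 sm; rewrite E sub0r normrN.
Qed.

Lemma almost_differentiable_right_derivative x h :
  (forall n, almost_differentiable h n x) -> p x h + p x (- h) = 0.
Proof.
move=> xh; apply/eqP; rewrite -normr_le0 leNgt; apply/negP => c0.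
set c := `|_| in c0; have c2 : 0 < c / 2 by rewrite divr_gt0.
have [m qm] := right_limit_seq c2 (@right_derivative_opp_cvg x h).
have [n] := ltr_add_invr c2; rewrite add0r => nc.
(* At this step the sum is smaller than [c / 2] and within [c / 2] of its limit, whose norm is
   [c]. *)
have [t [t0 tm] /= tc] := xh (maxn m n).
have inv_le (j : nat) : (j <= maxn m n)%N ->
    (maxn m n).+1%:R^-1 <= j.+1%:R^-1 :> R.
  by move=> jm; rewrite lef_pV2 ?posrE // ler_nat.
have H1 := qm t t0 (lt_le_trans tm (inv_le _ (leq_maxl _ _))).
have H2 := lt_trans (lt_le_trans tc (inv_le _ (leq_maxr _ _))) nc.
have := ler_normD (p x h + p x (- h) - (q x h t + q x (- h) t))
  (q x h t + q x (- h) t).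
by rewrite subrK -/c; lra.
Qed.

End Paraconvex.

(** * The generic set from Baire's theorem *)

Unset Implicit Arguments.

Theorem theorem3p5 (R : realType) (X Y : completeNormedModType R)
    (sepX : separable_space X) (sepY : separable_space Y)
    (reflY : reflexive_space Y)
    (alpha : R -> R) (alphaP : paraconvexity_modulus alpha)
    (K : set Y) (coneK : convex_cone K) (closedK : closed K)
    (normalK : normal_cone K)
    (k : Y) (Kk : K k) (k_neq0 : k <> 0)
    (f : X -> Y) (f_paraconvex : strongly_paraconvex alpha K k setT f)
    (f_bounded : locally_vector_bounded K setT f) :
  exists D : set X, [/\ Gdelta D, dense D &
    forall x : X, D x -> gateaux_differentiable f x].
Proof.
have [f_cont [C C0 fC]] := f_paraconvex.
have {}fC x y l := fC x y l I I.
have [d dd] := separable_seq sepX.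
pose A h n := almost_differentiable f h n.
(* The pairs are enumerated by one index for Baire's theorem; an index that codes no pair gets the
   whole space. *)
pose G i := if unpickle i is Some (j, n) then A (d j) n else setT.
have oG i : open (G i).
  rewrite /G; case: unpickle => [[j n]|]; last exact: openT.
  exact: almost_differentiable_open.
have dG i : dense (G i).
  rewrite /G; case: unpickle => [[j n]|].
    exact: (almost_differentiable_dense alphaP coneK Kk C0 fC).
  by move=> U U0 _; rewrite setIT.
exists (\bigcap_i G i); split; [by exists G|exact: Baire|].
move=> x Gx.
apply: (gateaux_right_derivative alphaP coneK Kk C0 fC) => //.
apply: (right_derivative_opp_dense alphaP coneK Kk C0 fC) dd _ => // j.
apply: (almost_differentiable_right_derivative alphaP coneK Kk C0 fC) => // n.
by have := Gx (pickle (j, n)) I; rewrite /G pickleK.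
Qed.
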